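(* Let $0<q<1$, $t>0$ with $tq<1$, and $k\in\mathbb{N}$. The negative binomialised Meixner factorial moments $M^{1,2}_q(k;t)$ satisfy the three-term recurrence $$M^{1,2}_q(k+1;t)=\frac{(2k+1)q(1+t)}{(1-q)(1-tq)}M^{1,2}_q(k;t)-\left(\frac{kq(1-t)}{(1-q)(1-tq)}\right)^2M^{1,2}_q(k-1;t),$$ and the second order differential equation $$t(1-t)\frac{\mathrm{d}^2}{\mathrm{d}t^2}M^{1,2}_q(k;t)+\frac{qt^2-(1-2k(1-q)+q)t+1}{1-qt}\frac{\mathrm{d}}{\mathrm{d}t}M^{1,2}_q(k;t)-\frac{kq(1-t)+k^2(1-q^2t)}{(1-qt)^2}M^{1,2}_q(k;t)=0.$$
   Context: Conventions: $\mathbb{N}=\{0,1,2,\dots\}$; an empty product is $1$. For $k=0$ the term of the recurrence containing $M^{1,2}_q(k-1;t)$ has coefficient $0$ and is omitted. Hypergeometric notation: $(a)_i=a(a+1)\cdots(a+i-1)$ and ${}_2F_1\left(\begin{matrix}a,b\\ c\end{matrix};z\right)=\sum_{i\ge0}\frac{(a)_i(b)_i}{(c)_i}\frac{z^i}{i!}$, which terminates if $a$ or $b$ is a nonpositive integer. The geometric reference measure is $\mu_q^1(x)=q^x(1-q)$, $x\in\mathbb{N}$. The normalised Meixner polynomials with $\gamma=1$ are $m_n(x;1,q)=q^{n/2}\;{}_2F_1\left(\begin{matrix}-n,-x\\ 1\end{matrix};1-\frac1q\right)$, $n\in\mathbb{N}$. The Meixner ($\gamma=1$) one-point function with $N\ge1$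 particles is the probability mass function on $\mathbb{N}$ given by $\rho^1_{N,q}(x)=\frac1N\sum_{n=0}^{N-1}m_n(x;1,q)^2\mu_q^1(x)$. The 2-negative binomialised Meixner factorial moment, as a function of $k\in\mathbb{N}$ and $t\in(0,1/q)$, is $$M^{1,2}_q(k;t)=\sum_{m\ge0}(m+1)(tq)^m(1-tq)^2\sum_{x\ge0}x(x-1)\cdots(x-k+1)\,\rho^1_{m+1,q}(x).$$ *)

(* Defs.v *)
(* Stdlib's real numbers [R] with Coquelicot series and derivatives. *)
From Stdlib Require Import Reals.
From Coquelicot Require Import Coquelicot.
Local Open Scope R_scope.

Fixpoint pochhammer (a : R) (i : nat) : R :=
  match i with
  | O => 1
  | S j => pochhammer a j * (a + INR j)
  end.

Fixpoint falling (x : R) (k : nat) : R :=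
  match k with
  | O => 1
  | S j => falling x j * (x - INR j)
  end.

Definition hyp2F1 (a b c z : R) : R :=
  Series (fun i : nat =>
    pochhammer a i * pochhammer b i / pochhammer c i
      * (z ^ i / INR (Factorial.fact i))).

Definition geom_weight (q : R) (x : nat) : R := q ^ x * (1 - q).

(* Meixner polynomials with gamma = 1, orthonormal for [geom_weight q].
   The hypergeometric series terminates, since [- INR n] is a parameter. *)
Definition meixner (q : R) (n x : nat) : R :=
  Rpower q (INR n / 2) * hyp2F1 (- INR n) (- INR x) 1 (1 - 1 / q).

(* Meant for [1 <= N]: [sum_f_R0 f (N - 1)] is f 0 + ... + f (N - 1). *)
Definition one_point (N : nat) (q : R) (x : nat) : R :=
  / INR N
    * sum_f_R0 (fun n : nat => (meixner q n x) ^ 2 * geom_weight q x) (N - 1).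

Definition moment_term (N : nat) (q : R) (k x : nat) : R :=
  falling (INR x) k * one_point N q x.

Definition negbin_term (q : R) (k : nat) (t : R) (m : nat) : R :=
  INR (m + 1) * (t * q) ^ m * (1 - t * q) ^ 2
    * Series (moment_term (m + 1) q k).

(* The 2-negative binomialised factorial moment M^{1,2}_q(k;t). [Series] is
   total: the value is meaningful only when both series converge. *)
Definition negbin_moment (q : R) (k : nat) (t : R) : R :=
  Series (negbin_term q k t).

(* Main.v *)
(* Write [F n x = 2F1(-n, -x; 1; 1 - 1/q)], so that
   [sum_n F n x v^n = (1 - v/q)^x / (1 - v)^(x+1)]. Multiplying two such
   generating functions and summing over [x] against [binom x k q^x] gives
     [q^k / (1 - q)^(k+1) (1 - v/q)^k (1 - w/q)^k / (1 - v w/q)^(k+1)],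
   whose diagonal coefficients are, up to [k!], the factorial moments of
   [F n ^ 2]. Here this
   is done on coefficients, through the difference equation
   [F (n+1) (x+1) - F n (x+1) = F (n+1) x - F n x / q].
   Summing the diagonal against [(t q)^n] yields the closed form
     [M(k;t) = k! (q / ((1-q)(1-tq)))^k sum_i binom k i ^ 2 t^i],
   and the recurrence and the differential equation reduce to those of the
   Legendre polynomials. *)
Require Import Defs.
From Stdlib Require Import Reals.
From Coquelicot Require Import Coquelicot.
From Stdlib Require Import Lra Lia.
Local Open Scope R_scope.

(** * Binomial coefficients with a real upper argument *)

Definition binom (x : R) (i : nat) : R := falling x i / INR (Factorial.fact i).

Lemma binom_0_r (x : R) : binom x 0 = 1.
Proof. unfold binom; simpl; field. Qed.

Lemma binom_S (x : R) (i : nat) :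
  INR (S i) * binom x (S i) = (x - INR i) * binom x i.
Proof.
unfold binom; rewrite fact_simpl, mult_INR; cbn [falling].
field; split; [apply INR_fact_neq_0 | apply not_0_INR; lia].
Qed.

Lemma falling_succ (x : R) (i : nat) :
  falling (x + 1) (S i) = falling x (S i) + INR (S i) * falling x i.
Proof.
induction i as [|i IH]; [simpl; ring|].
change (falling (x + 1) (S (S i)))
  with (falling (x + 1) (S i) * (x + 1 - INR (S i))).
rewrite IH, !S_INR; cbn [falling]; rewrite !S_INR; ring.
Qed.

Lemma binom_pascal (x : R) (i : nat) :
  binom (x + 1) (S i) = binom x (S i) + binom x i.
Proof.
unfold binom; rewrite falling_succ, fact_simpl, mult_INR.
field; split; [apply INR_fact_neq_0 | apply not_0_INR; lia].
Qed.

Lemma binom_INR_S (n i : nat) :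
  binom (INR (S n)) (S i) = binom (INR n) (S i) + binom (INR n) i.
Proof. now rewrite S_INR, binom_pascal. Qed.

Lemma falling_gt (n i : nat) : (n < i)%nat -> falling (INR n) i = 0.
Proof.
induction 1 as [|i _ IH]; cbn [falling]; [|rewrite IH]; ring.
Qed.

Lemma binom_gt (n i : nat) : (n < i)%nat -> binom (INR n) i = 0.
Proof. intros H; unfold binom; rewrite falling_gt by easy; apply Rdiv_0_l. Qed.

Lemma binom_diag (n : nat) : binom (INR n) n = 1.
Proof.
induction n as [|n IH]; [apply binom_0_r|].
rewrite binom_INR_S, IH, binom_gt by lia; ring.
Qed.

Lemma binom_ge_0 (n i : nat) : 0 <= binom (INR n) i.
Proof.
revert i; induction n as [|n IH]; intros [|i]; try (rewrite binom_0_r; lra).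
- rewrite binom_gt by lia; lra.
- rewrite binom_INR_S; apply Rplus_le_le_0_compat; apply IH.
Qed.

(** * Finite sums and linearity of series *)

Lemma sum_f_R0_extend (a : nat -> R) (n N : nat) :
  (forall i, (n < i)%nat -> a i = 0) -> (n <= N)%nat ->
  sum_f_R0 a N = sum_f_R0 a n.
Proof.
intros Ha; induction 1 as [|N HN IH]; [easy|].
rewrite tech5, IH, Ha by lia; ring.
Qed.

Lemma is_series_ext_R (a b : nat -> R) (l : R) :
  (forall n, a n = b n) -> is_series a l -> is_series b l.
Proof. exact (is_series_ext (V := R_NormedModule) a b l). Qed.

Lemma is_series_scal_R (c : R) (a : nat -> R) (l : R) :
  is_series a l -> is_series (fun n => c * a n) (c * l).
Proof. exact (is_series_scal_l (V := R_NormedModule) c a l). Qed.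

Lemma is_series_plus_R (a b : nat -> R) (la lb : R) :
  is_series a la -> is_series b lb ->
  is_series (fun n => a n + b n) (la + lb).
Proof. exact (is_series_plus (V := R_NormedModule) a b la lb). Qed.

Lemma is_series_finite (a : nat -> R) (n : nat) :
  (forall i, (n < i)%nat -> a i = 0) -> is_series a (sum_f_R0 a n).
Proof.
intros Ha; apply is_series_Reals; intros eps Heps; exists n; intros N HN.
rewrite (sum_f_R0_extend a n N) by easy.
now unfold R_dist; rewrite Rminus_diag, Rabs_R0.
Qed.

(** * Meixner polynomials as binomial sums *)

(** The terminating hypergeometric series: the signs of $(-n)_i$ and $(-x)_i$ cancel and $(1)_i =
    i!$, which leaves two binomials. *)
Definition meixner_sum (q : R) (n x : nat) : R :=
  sum_f_R0 (fun i => binom (INR n) i * binom (INR x) i * (1 - 1 / q) ^ i) n.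

Lemma meixner_sum_extend (q : R) (n x N : nat) : (n <= N)%nat ->
  sum_f_R0 (fun i => binom (INR n) i * binom (INR x) i * (1 - 1 / q) ^ i) N
  = meixner_sum q n x.
Proof.
intros HN; apply sum_f_R0_extend; [|easy].
intros i Hi; rewrite binom_gt by easy; ring.
Qed.

(** Pascal's rule in both arguments. By inclusion-exclusion the product of the two sums consists of
    terms of the three neighbours, plus one product with its index lowered by one; realigning that
    index costs the factor [1 - 1 / q]. *)
Lemma meixner_sum_S (q : R) (n x : nat) :
  meixner_sum q (S n) (S x) - meixner_sum q n (S x)
  = meixner_sum q (S n) x - / q * meixner_sum q n x.
Proof.
pose (B := fun n x N => sum_f_R0 (fun i =>
  binom (INR n) i * binom (INR x) i * (1 - 1 / q) ^ i) N).
assert (H : forall N, B (S n) (S x) (S N)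
  = B n (S x) (S N) + B (S n) x (S N) - B n x (S N) + (1 - 1 / q) * B n x N).
{ induction N as [|N IH].
  - unfold B; cbn [sum_f_R0]; rewrite !binom_0_r, !binom_INR_S, !binom_0_r; ring.
  - unfold B in *; rewrite tech5, IH, !(tech5 _ (S N)), !(tech5 _ N).
    rewrite !binom_INR_S; simpl pow; ring. }
specialize (H n); unfold B in H; rewrite !meixner_sum_extend in H by lia.
rewrite H; unfold Rdiv; ring.
Qed.

Lemma meixner_sum_at_0 (q : R) (n : nat) : meixner_sum q n 0 = 1.
Proof.
unfold meixner_sum; rewrite (sum_f_R0_extend _ 0 n); [| |lia].
- simpl; rewrite !binom_0_r; ring.
- intros i Hi; rewrite (binom_gt 0 i) by easy; ring.
Qed.

Lemma meixner_sum_0 (q : R) (x : nat) : meixner_sum q 0 x = 1.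
Proof. unfold meixner_sum; simpl; rewrite !binom_0_r; ring. Qed.

Lemma pochhammer_opp (x : R) (i : nat) :
  pochhammer (- x) i = (-1) ^ i * falling x i.
Proof. induction i as [|i IH]; simpl; [ring|rewrite IH; ring]. Qed.

Lemma pochhammer_1 (i : nat) : pochhammer 1 i = INR (Factorial.fact i).
Proof.
induction i as [|i IH]; [reflexivity|].
rewrite fact_simpl, mult_INR, S_INR; simpl; rewrite IH; ring.
Qed.

Lemma meixner_sqr (q : R) (n x : nat) : 0 < q ->
  meixner q n x ^ 2 = q ^ n * meixner_sum q n x ^ 2.
Proof.
intros Hq; unfold meixner.
replace (hyp2F1 _ _ _ _) with (meixner_sum q n x).
- rewrite Rpow_mult_distr; f_equal.
  rewrite <- (Rpower_pow n q Hq), <- (Rpower_pow 2) by apply exp_pos.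
  rewrite Rpower_mult; f_equal; simpl; field.
- symmetry; apply is_series_unique.
  eapply is_series_ext_R; [|apply (is_series_finite (fun i =>
    binom (INR n) i * binom (INR x) i * (1 - 1 / q) ^ i) n)].
  + intros i; rewrite !pochhammer_opp, pochhammer_1; unfold binom.
    replace ((-1) ^ i * falling (INR n) i * ((-1) ^ i * falling (INR x) i))
      with (falling (INR n) i * falling (INR x) i).
    * field; apply INR_fact_neq_0.
    * transitivity (((-1) * (-1)) ^ i * falling (INR n) i * falling (INR x) i).
      -- replace (-1 * -1) with 1 by ring; rewrite pow1; ring.
      -- rewrite Rpow_mult_distr; ring.
  + intros i Hi; rewrite binom_gt by easy; ring.
Qed.

(** * Subexponential growth and convergence *)

(* Unlike summability against every [r ^ n], this is clearly stable under
   products: split [r] as [sqrt r * sqrt r]. *)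
Definition subexp (f : nat -> R) : Prop :=
  forall r, 0 < r < 1 -> exists M, forall n, Rabs (f n) * r ^ n <= M.

Lemma subexp_const (c : R) : subexp (fun _ => c).
Proof.
intros r Hr; exists (Rabs c); intros n.
rewrite <- (Rmult_1_r (Rabs c)) at 2.
apply Rmult_le_compat_l; [apply Rabs_pos|].
rewrite <- (pow1 n); apply pow_incr; lra.
Qed.

Lemma subexp_INR : subexp INR.
Proof.
intros r Hr; exists (/ (/ r - 1)); intros n.
assert (H1 : 0 < / r - 1).
{ apply Rlt_0_minus; rewrite <- Rinv_1 at 1; apply Rinv_lt_contravar; lra. }
(* [poly] is Bernoulli's inequality. *)
assert (H := poly n (/ r - 1) H1).
replace (1 + (/ r - 1)) with (/ r) in H by ring; rewrite pow_inv in H.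
assert (Hp : 0 < r ^ n) by (apply pow_lt; lra).
rewrite Rabs_pos_eq by apply pos_INR.
apply (Rmult_le_reg_r (/ r - 1)); [easy|].
rewrite Rinv_l by lra.
apply (Rmult_le_compat_r (r ^ n)) in H; [|lra].
rewrite Rinv_l in H by lra.
nra.
Qed.

Lemma subexp_plus (f g : nat -> R) :
  subexp f -> subexp g -> subexp (fun n => f n + g n).
Proof.
intros Hf Hg r Hr; destruct (Hf r Hr) as [M HM], (Hg r Hr) as [M' HM'].
exists (M + M'); intros n; specialize (HM n); specialize (HM' n).
assert (Hp : 0 < r ^ n) by (apply pow_lt; lra).
assert (H := Rabs_triang (f n) (g n)); nra.
Qed.

Lemma sqrt_bounds (r : R) : 0 < r < 1 -> 0 < sqrt r < 1.
Proof.
intros Hr; split; [apply sqrt_lt_R0; lra|].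
rewrite <- sqrt_1; apply sqrt_lt_1_alt; lra.
Qed.

Lemma subexp_mult (f g : nat -> R) :
  subexp f -> subexp g -> subexp (fun n => f n * g n).
Proof.
intros Hf Hg r Hr; assert (Hs := sqrt_bounds r Hr).
destruct (Hf _ Hs) as [M HM], (Hg _ Hs) as [M' HM'].
exists (M * M'); intros n.
assert (Hp : 0 < sqrt r ^ n) by (apply pow_lt; lra).
rewrite <- (sqrt_sqrt r) at 1 by lra.
rewrite Rabs_mult, Rpow_mult_distr.
replace (Rabs (f n) * Rabs (g n) * (sqrt r ^ n * sqrt r ^ n))
  with ((Rabs (f n) * sqrt r ^ n) * (Rabs (g n) * sqrt r ^ n)) by ring.
apply Rmult_le_compat; try easy;
  apply Rmult_le_pos; (apply Rabs_pos || lra).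
Qed.

Lemma subexp_ext (f g : nat -> R) :
  (forall n, f n = g n) -> subexp f -> subexp g.
Proof.
intros H Hf r Hr; destruct (Hf r Hr) as [M HM]; exists M; intros n.
now rewrite <- H.
Qed.

Lemma subexp_sum (f : nat -> nat -> R) (N : nat) :
  (forall i, subexp (f i)) -> subexp (fun n => sum_f_R0 (fun i => f i n) N).
Proof.
intros H; induction N as [|N IH]; simpl; [apply H|].
now apply subexp_plus.
Qed.

Lemma subexp_falling (f : nat -> R) (i : nat) :
  subexp f -> subexp (fun n => falling (f n) i).
Proof.
intros Hf; induction i as [|i IH]; simpl; [apply subexp_const|].
apply subexp_mult; [easy|].
apply subexp_plus; [easy|apply subexp_const].
Qed.

Lemma subexp_binom (f : nat -> R) (i : nat) :
  subexp f -> subexp (fun n => binom (f n) i).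
Proof.
intros Hf; apply subexp_mult; [now apply subexp_falling|apply subexp_const].
Qed.

Lemma subexp_meixner_sum (q : R) (n : nat) : subexp (meixner_sum q n).
Proof.
apply (subexp_sum
  (fun i x => binom (INR n) i * binom (INR x) i * (1 - 1 / q) ^ i)); intros i.
apply subexp_mult; [apply subexp_mult|]; try apply subexp_const.
apply subexp_binom, subexp_INR.
Qed.

(** Of the two factors [sqrt r ^ n] in [r ^ n], one bounds [f] and the other gives a convergent
    geometric series. *)
Lemma ex_series_subexp (f : nat -> R) (r : R) :
  subexp f -> 0 < r < 1 -> ex_series (fun n => r ^ n * f n).
Proof.
intros Hf Hr; assert (Hs := sqrt_bounds r Hr).
destruct (Hf _ Hs) as [M HM].
apply (ex_series_le (V := R_CompleteNormedModule) _ (fun n => M * sqrt r ^ n)).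
- intros n; change (Rabs (r ^ n * f n) <= M * sqrt r ^ n).
  assert (Hp : 0 < sqrt r ^ n) by (apply pow_lt; lra).
  rewrite <- (sqrt_sqrt r) at 1 by lra.
  rewrite Rpow_mult_distr, !Rabs_mult, Rabs_pos_eq by lra.
  specialize (HM n); nra.
- apply (ex_series_scal_l (V := R_NormedModule) M), ex_series_geom.
  rewrite Rabs_pos_eq; lra.
Qed.

(** * The weighted pairing and its recurrence *)

(** Up to the factor [(1 - q)] and $k!$, the diagonal values are the factorial moments of $f^2$
    under the geometric weight. A bilinear form is needed because the recurrence mixes different
    functions. *)
Definition pairing (q : R) (k : nat) (f g : nat -> R) : R :=
  Series (fun x => q ^ x * (binom (INR x) k * f x * g x)).

(* The functions [f] and [f'] stand for consecutive Meixner polynomials. *)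
Lemma pairing_shift (q : R) (k : nat) (f f' g g' : nat -> R) :
  0 < q < 1 -> subexp f -> subexp f' -> subexp g -> subexp g' ->
  (forall x, f (S x) - f' (S x) = f x - / q * f' x) ->
  (forall x, g (S x) - g' (S x) = g x - / q * g' x) ->
  (1 - q) * (pairing q k f g - / q * pairing q k f' g')
  = match k with
    | O => (f 0%nat - f' 0%nat) * (g 0%nat - g' 0%nat)
    | S j => q * (pairing q j f g - / q * pairing q j f' g
                  - / q * pairing q j f g' + / q * / q * pairing q j f' g')
    end.
Proof.
intros Hq Sf Sf' Sg Sg' Hf Hg.
assert (Hex : forall k u v, subexp u -> subexp v ->
  is_series (fun x => q ^ x * (binom (INR x) k * u x * v x)) (pairing q k u v)).
{ intros j u v Su Sv; apply Series_correct, ex_series_subexp; [|easy].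
  apply subexp_mult; [|easy]; apply subexp_mult; [|easy].
  apply subexp_binom, subexp_INR. }
(* The constant [c] is left free: [-1] and [- / q] give the two sides of the difference equation. *)
assert (Hlin : forall k c, is_series (fun x => q ^ x * (binom (INR x) k *
    ((f x + c * f' x) * (g x + c * g' x))))
  (pairing q k f g + c * pairing q k f' g
     + c * pairing q k f g' + c * c * pairing q k f' g')).
{ intros j c; eapply is_series_ext_R; [|
    apply is_series_plus_R; [apply is_series_plus_R; [apply is_series_plus_R|]|];
    [apply (Hex j f g Sf Sg)
    |apply (is_series_scal_R c), (Hex j f' g Sf' Sg)
    |apply (is_series_scal_R c), (Hex j f g' Sf Sg')
    |apply (is_series_scal_R (c * c)), (Hex j f' g' Sf' Sg')]].
  intros x; cbv beta; ring. }
(* Past [x = 0], the difference equation turns each term for [c = -1] into one for [c = - / q], with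
   an extra [q] from the shift of [x]. *)
assert (H1 := is_series_unique _ _ (Hlin k (-1))).
rewrite Series_incr_1 in H1 by (eexists; apply (Hlin k (-1))).
rewrite (Series_ext _ (fun x => q * (q ^ x * (binom (INR (S x)) k *
    ((f x + - / q * f' x) * (g x + - / q * g' x)))))) in H1.
2:{ intros x.
  replace (f (S x) + -1 * f' (S x)) with (f x + - / q * f' x)
    by (specialize (Hf x); lra).
  replace (g (S x) + -1 * g' (S x)) with (g x + - / q * g' x)
    by (specialize (Hg x); lra).
  simpl pow; ring. }
rewrite Series_scal_l in H1.
destruct k as [|k].
- rewrite (Series_ext _ (fun x => q ^ x * (binom (INR x) 0 *
    ((f x + - / q * f' x) * (g x + - / q * g' x))))) in H1
    by (intros x; now rewrite !binom_0_r).
  rewrite (is_series_unique _ _ (Hlin 0%nat (- / q))), binom_0_r in H1.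
  simpl pow in H1.
  (* The mixed pairings cancel because $q \cdot (-1/q) = -1$, so only the term at [x = 0]
     survives. *)
  assert (E : q * (pairing q 0 f g + - / q * pairing q 0 f' g
     + - / q * pairing q 0 f g' + - / q * - / q * pairing q 0 f' g')
     = q * pairing q 0 f g - pairing q 0 f' g - pairing q 0 f g'
       + / q * pairing q 0 f' g') by (field; lra).
  rewrite E in H1.
  assert (E2 : (1 - q) * (pairing q 0 f g - / q * pairing q 0 f' g')
    = (1 - q) * pairing q 0 f g + pairing q 0 f' g' - / q * pairing q 0 f' g')
    by (field; lra).
  rewrite E2; lra.
(* Pascal's rule splits the shifted weight: the part at level [S k] is absorbed as for [k = 0], the
   part at level [k] is the right-hand side, and the term at [x = 0] vanishes. *)
- rewrite (Series_ext _ (fun x => q ^ x * (binom (INR x) (S k) *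
    ((f x + - / q * f' x) * (g x + - / q * g' x))) +
    q ^ x * (binom (INR x) k *
    ((f x + - / q * f' x) * (g x + - / q * g' x))))) in H1
    by (intros x; rewrite binom_INR_S; ring).
  rewrite Series_plus in H1 by (eexists; apply Hlin).
  rewrite (is_series_unique _ _ (Hlin k (- / q))) in H1.
  rewrite (is_series_unique _ _ (Hlin (S k) (- / q))) in H1.
  rewrite (binom_gt 0) in H1 by lia.
  set (Y := pairing q k f g + - / q * pairing q k f' g
     + - / q * pairing q k f g' + - / q * - / q * pairing q k f' g') in H1.
  replace (_ - _ - _ + _) with Y by (unfold Y; ring).
  apply (Rplus_eq_reg_l (q * (pairing q (S k) f g + - / q * pairing q (S k) f' g
     + - / q * pairing q (S k) f g' + - / q * - / q * pairing q (S k) f' g'))).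
  rewrite <- Rmult_plus_distr_l.
  transitivity (pairing q (S k) f g + -1 * pairing q (S k) f' g +
     -1 * pairing q (S k) f g' + -1 * -1 * pairing q (S k) f' g').
  + field; lra.
  + rewrite <- H1; ring.
Qed.

(** * Coefficients of the generating function *)

(** On coefficient sequences, multiplication by the variable of the generating function. *)
Definition prev (f : nat -> R) (n : nat) : R :=
  match n with O => 0 | S j => f j end.

(* Coefficient of [v ^ n] in [v ^ j * (1 - v / q) ^ k]. *)
Fixpoint shifted_coef (q : R) (k j n : nat) : R :=
  match k with
  | O => if Nat.eqb n j then 1 else 0
  | S i => shifted_coef q i j n - / q * prev (shifted_coef q i j) n
  end.

Lemma shifted_coef_shift (q : R) (k j n : nat) :
  shifted_coef q k (S j) n = prev (shifted_coef q k j) n.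
Proof.
revert n; induction k as [|k IH]; intros [|n]; cbn [shifted_coef prev].
- easy.
- easy.
- rewrite IH; simpl; ring.
- rewrite !IH; simpl; destruct n; simpl; now rewrite ?IH.
Qed.

Lemma shifted_coef_lt (q : R) (k j n : nat) :
  (n < j)%nat -> shifted_coef q k j n = 0.
Proof.
revert n; induction j as [|j IH]; intros [|n] H; try lia;
  rewrite shifted_coef_shift; [easy|apply IH; lia].
Qed.

(** The binomial theorem for $(1 - v/q)^k$, read past the leading factor $v^j$. *)
Lemma shifted_coef_add (q : R) (k j i : nat) :
  shifted_coef q k j (j + i) = binom (INR k) i * (- / q) ^ i.
Proof.
induction j as [|j IH]; [|now rewrite Nat.add_succ_l, shifted_coef_shift].
rewrite Nat.add_0_l; revert i; induction k as [|k IH]; intros [|i].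
- simpl; rewrite binom_0_r; ring.
- rewrite binom_gt by lia; simpl; ring.
- cbn [shifted_coef prev]; rewrite IH, !binom_0_r; simpl; ring.
- cbn [shifted_coef prev]; rewrite !IH, binom_INR_S; simpl; ring.
Qed.

(* Coefficient of [w ^ j] in [1 / (1 - w / q) ^ (k + 1)]. *)
Definition negbin_coef (q : R) (k j : nat) : R :=
  binom (INR (j + k)) k * (/ q) ^ j.

Lemma negbin_coef_0_r (q : R) (k : nat) : negbin_coef q k 0 = 1.
Proof. unfold negbin_coef; rewrite Nat.add_0_l, binom_diag; simpl; ring. Qed.

(** Multiplying $1/(1 - w/q)^{k+2}$ by $1 - w/q$ lowers the exponent by one. *)
Lemma negbin_coef_S (q : R) (k j : nat) :
  negbin_coef q (S k) (S j) - / q * negbin_coef q (S k) j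
  = negbin_coef q k (S j).
Proof.
unfold negbin_coef; rewrite Nat.add_succ_l, binom_INR_S, <- Nat.add_succ_comm.
simpl pow; ring.
Qed.

(** Summation by parts: lowering both [n] and [m] amounts to raising [j], so multiplying the
    generating function by $1 - vw/q$ can be moved onto the coefficients in [j]. *)
Lemma sum_shifted_coef (q : R) (k n m N : nat) : (n <= N)%nat ->
  sum_f_R0 (fun j => shifted_coef q k j n * shifted_coef q k j m
                     * negbin_coef q k j) N
  - / q * sum_f_R0 (fun j => prev (shifted_coef q k j) n
                     * prev (shifted_coef q k j) m * negbin_coef q k j) N
  = sum_f_R0 (fun j => shifted_coef q k j n * shifted_coef q k j m
      * (negbin_coef q k j - / q * prev (negbin_coef q k) j)) N.
Proof.
intros HN.
(* The induction on [N] carries the boundary term, which vanishes for [n <= N] since a multiple of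
   $v^{N+1}$ has no coefficient at $v^n$. *)
enough (H : forall N, sum_f_R0 (fun j => shifted_coef q k j n
       * shifted_coef q k j m * negbin_coef q k j) N
  - / q * sum_f_R0 (fun j => prev (shifted_coef q k j) n
                     * prev (shifted_coef q k j) m * negbin_coef q k j) N
  = sum_f_R0 (fun j => shifted_coef q k j n * shifted_coef q k j m
      * (negbin_coef q k j - / q * prev (negbin_coef q k) j)) N
    - / q * (shifted_coef q k (S N) n * shifted_coef q k (S N) m
      * negbin_coef q k N)).
{ rewrite H, (shifted_coef_lt q k (S N) n) by lia; ring. }
clear N HN; induction N as [|N IH].
- simpl; rewrite !shifted_coef_shift; ring.
- rewrite !tech5, Rmult_plus_distr_l.
  transitivity (sum_f_R0 (fun j => shifted_coef q k j n
       * shifted_coef q k j m * negbin_coef q k j) N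
  - / q * sum_f_R0 (fun j => prev (shifted_coef q k j) n
                     * prev (shifted_coef q k j) m * negbin_coef q k j) N
  + (shifted_coef q k (S N) n * shifted_coef q k (S N) m * negbin_coef q k (S N)
    - / q * (prev (shifted_coef q k (S N)) n * prev (shifted_coef q k (S N)) m
       * negbin_coef q k (S N)))); [ring|].
  rewrite IH, <- !shifted_coef_shift; cbn [prev]; ring.
Qed.

Lemma sum_shifted_coef_0 (q : R) (n m N : nat) :
  sum_f_R0 (fun j => shifted_coef q 0 j n * shifted_coef q 0 j m
      * (negbin_coef q 0 j - / q * prev (negbin_coef q 0) j)) N
  = shifted_coef q 0 0 n * shifted_coef q 0 0 m.
Proof.
rewrite (sum_f_R0_extend _ 0); [| |lia].
- cbn [sum_f_R0 prev]; rewrite negbin_coef_0_r; ring.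
- intros [|j] Hj; [lia|]; unfold negbin_coef; cbn [prev].
  rewrite !binom_0_r; simpl; ring.
Qed.

(** The two new factors $1 - v/q$ and $1 - w/q$ expand into four terms, while the difference in [j]
    cancels one power of the denominator. This matches the recurrence of [pairing_shift]. *)
Lemma sum_shifted_coef_S (q : R) (k n m N : nat) :
  let T f g := sum_f_R0 (fun j => f j n * g j m * negbin_coef q k j) N in
  let p := shifted_coef q k in
  let p' j := prev (shifted_coef q k j) in
  sum_f_R0 (fun j => shifted_coef q (S k) j n * shifted_coef q (S k) j m
      * (negbin_coef q (S k) j - / q * prev (negbin_coef q (S k)) j)) N
  = T p p - / q * T p' p - / q * T p p' + / q * / q * T p' p'.
Proof.
intros T p p'; subst T p p'; induction N as [|N IH].
- cbn [sum_f_R0 prev shifted_coef]; rewrite !negbin_coef_0_r; ring.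
- rewrite !tech5, IH; cbn [prev shifted_coef]; rewrite negbin_coef_S; ring.
Qed.

(** * Pairings of Meixner polynomials *)

Lemma pairing_0_l (q : R) (k : nat) (g : nat -> R) :
  pairing q k (fun _ => 0) g = 0.
Proof.
unfold pairing; rewrite (Series_ext _ (fun _ => 0 * 0)) by (intros; ring).
rewrite Series_scal_l; ring.
Qed.

Lemma pairing_0_r (q : R) (k : nat) (f : nat -> R) :
  pairing q k f (fun _ => 0) = 0.
Proof.
unfold pairing; rewrite (Series_ext _ (fun _ => 0 * 0)) by (intros; ring).
rewrite Series_scal_l; ring.
Qed.

(** Setting $F_{-1} = 0$ extends the difference equation to [n = 0]. As every $F_n$ is 1 at [x = 0],
    the boundary difference is nonzero only for [n = 0]. *)
Lemma pairing_meixner_shift (q : R) (k n m : nat) : 0 < q < 1 ->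
  let F := meixner_sum q in
  let F' n x := prev (fun i => meixner_sum q i x) n in
  (1 - q) * (pairing q k (F n) (F m) - / q * pairing q k (F' n) (F' m))
  = match k with
    | O => shifted_coef q 0 0 n * shifted_coef q 0 0 m
    | S j => q * (pairing q j (F n) (F m) - / q * pairing q j (F' n) (F m)
                  - / q * pairing q j (F n) (F' m)
                  + / q * / q * pairing q j (F' n) (F' m))
    end.
Proof.
intros Hq F F'.
assert (HS : forall n x, F n (S x) - F' n (S x) = F n x - / q * F' n x).
{ intros [|i] x; unfold F, F'; cbn [prev];
    [rewrite !meixner_sum_0; ring|apply meixner_sum_S]. }
assert (H0 : forall n, F n 0%nat - F' n 0%nat = shifted_coef q 0 0 n).
{ intros [|i]; unfold F, F'; cbn [prev]; rewrite !meixner_sum_at_0; simpl; ring. }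
assert (Hsub : forall n, subexp (F' n)).
{ intros [|i]; [apply subexp_const|apply subexp_meixner_sum]. }
rewrite (pairing_shift q k (F n) (F' n) (F m) (F' m));
  try (easy || apply subexp_meixner_sum).
now rewrite !H0.
Qed.

(* The right-hand side is the coefficient of [v ^ n * w ^ m] in the generating
   function of the header. *)
Lemma pairing_meixner (q : R) (k n m N : nat) : 0 < q < 1 -> (n <= N)%nat ->
  pairing q k (meixner_sum q n) (meixner_sum q m)
  = q ^ k / (1 - q) ^ S k
    * sum_f_R0 (fun j => shifted_coef q k j n * shifted_coef q k j m
                         * negbin_coef q k j) N.
Proof.
intros Hq; revert k n m N.
assert (Hz : forall (c : R) (f : nat -> R) N, (forall j, f j = 0) ->
  0 = c * sum_f_R0 f N).
{ intros c f N Hf; rewrite (sum_eq _ (fun _ => 0)) by easy.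
  rewrite sum_cte; ring. }
assert (Hpow : forall k, (1 - q) ^ k <> 0) by (intros k; apply pow_nonzero; lra).
(* Coefficientwise division by $1 - vw/q$: the value at [(n, m)] follows from the one at
   [(n - 1, m - 1)]. *)
assert (step : forall k n m N, (n <= N)%nat ->
  pairing q k (fun x => prev (fun i => meixner_sum q i x) n)
    (fun x => prev (fun i => meixner_sum q i x) m)
  = q ^ k / (1 - q) ^ S k
    * sum_f_R0 (fun j => prev (shifted_coef q k j) n * prev (shifted_coef q k j) m
                         * negbin_coef q k j) N ->
  (1 - q) * (pairing q k (meixner_sum q n) (meixner_sum q m)
    - / q * pairing q k (fun x => prev (fun i => meixner_sum q i x) n)
    (fun x => prev (fun i => meixner_sum q i x) m))
  = q ^ k / (1 - q) ^ k * sum_f_R0 (fun j =>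
      shifted_coef q k j n * shifted_coef q k j m
      * (negbin_coef q k j - / q * prev (negbin_coef q k) j)) N ->
  pairing q k (meixner_sum q n) (meixner_sum q m)
  = q ^ k / (1 - q) ^ S k
    * sum_f_R0 (fun j => shifted_coef q k j n * shifted_coef q k j m
                         * negbin_coef q k j) N).
{ intros k n m N HN Hprev H.
  rewrite <- (sum_shifted_coef q k n m N HN) in H.
  rewrite Hprev in H; simpl pow in *.
  apply (Rmult_eq_reg_l (1 - q)); [|lra].
  match type of H with (1 - q) * (_ - / q * ?Z) = _ =>
    transitivity ((1 - q) * (pairing q k (meixner_sum q n) (meixner_sum q m)
      - / q * Z) + (1 - q) * / q * Z) end; [ring|].
  rewrite H; field; repeat split; (lra || apply Hpow). }
(* The descent along the diagonal ends when an index is 0, where the lowered pairing is 0. *)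
assert (ind : forall k, (forall n m N, (n <= N)%nat ->
  (1 - q) * (pairing q k (meixner_sum q n) (meixner_sum q m)
    - / q * pairing q k (fun x => prev (fun i => meixner_sum q i x) n)
    (fun x => prev (fun i => meixner_sum q i x) m))
  = q ^ k / (1 - q) ^ k * sum_f_R0 (fun j =>
      shifted_coef q k j n * shifted_coef q k j m
      * (negbin_coef q k j - / q * prev (negbin_coef q k) j)) N) ->
  forall n m N, (n <= N)%nat ->
  pairing q k (meixner_sum q n) (meixner_sum q m)
  = q ^ k / (1 - q) ^ S k
    * sum_f_R0 (fun j => shifted_coef q k j n * shifted_coef q k j m
                         * negbin_coef q k j) N).
{ intros k H; induction n as [|n IHn]; intros m N HN; apply step; auto.
  - cbn [prev]; rewrite pairing_0_l; apply Hz; intros; ring.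
  - destruct m as [|m]; cbn [prev].
    + rewrite pairing_0_r; apply Hz; intros; ring.
    + apply IHn; lia. }
induction k as [|k IHk]; apply ind; intros n m N HN;
  rewrite (pairing_meixner_shift q _ n m Hq).
- rewrite sum_shifted_coef_0; simpl; field.
(* The four pairings on the right are at level [k]: each is given by [IHk], or is 0 when an index
   cannot be lowered. *)
- rewrite sum_shifted_coef_S.
  rewrite (IHk n m N HN).
  replace (pairing q k (fun x => prev (fun i => meixner_sum q i x) n)
      (meixner_sum q m)) with (q ^ k / (1 - q) ^ S k
    * sum_f_R0 (fun j => prev (shifted_coef q k j) n * shifted_coef q k j m
                         * negbin_coef q k j) N).
  2:{ destruct n as [|n]; cbn [prev].
      - rewrite pairing_0_l; symmetry; apply Hz; intros; ring.
      - symmetry; apply IHk; lia. }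
  replace (pairing q k (meixner_sum q n)
      (fun x => prev (fun i => meixner_sum q i x) m)) with (q ^ k / (1 - q) ^ S k
    * sum_f_R0 (fun j => shifted_coef q k j n * prev (shifted_coef q k j) m
                         * negbin_coef q k j) N).
  2:{ destruct m as [|m]; cbn [prev].
      - rewrite pairing_0_r; symmetry; apply Hz; intros; ring.
      - symmetry; apply IHk; lia. }
  replace (pairing q k (fun x => prev (fun i => meixner_sum q i x) n)
      (fun x => prev (fun i => meixner_sum q i x) m)) with (q ^ k / (1 - q) ^ S k
    * sum_f_R0 (fun j => prev (shifted_coef q k j) n * prev (shifted_coef q k j) m
                         * negbin_coef q k j) N).
  2:{ destruct n as [|n]; cbn [prev].
      - rewrite pairing_0_l; symmetry; apply Hz; intros; ring.
      - destruct m as [|m]; cbn [prev].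
        + rewrite pairing_0_r; symmetry; apply Hz; intros; ring.
        + symmetry; apply IHk; lia. }
  simpl pow; field; repeat split; (lra || apply Hpow).
Qed.

(** * Closed form of the moments *)

(** By Pascal's rule, [1 - u] times the series for [S k] is the series for [k]. *)
Lemma is_series_negbin (k : nat) (u : R) : 0 < u < 1 ->
  is_series (fun j => u ^ j * binom (INR (j + k)) k) (/ (1 - u) ^ S k).
Proof.
intros Hu.
assert (Hex : forall i, ex_series (fun j => u ^ j * binom (INR (j + i)) i)).
{ intros i; apply ex_series_subexp; [|easy]; apply subexp_binom.
  apply (subexp_ext (fun j => INR j + INR i)); [intros; now rewrite plus_INR|].
  apply subexp_plus; [apply subexp_INR|apply subexp_const]. }
induction k as [|k IH].
- apply (is_series_ext_R (fun j => u ^ j)).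
  + intros j; rewrite binom_0_r; ring.
  + rewrite pow_1; apply is_series_geom; rewrite Rabs_pos_eq; lra.
- replace (/ (1 - u) ^ S (S k))
    with (Series (fun j => u ^ j * binom (INR (j + S k)) (S k)));
    [apply Series_correct, Hex|].
  assert (H := Series_incr_1 _ (Hex (S k))).
  assert (H' := Series_incr_1 _ (Hex k)); cbv beta in H, H'.
  rewrite (is_series_unique _ _ IH) in H'.
  rewrite (Series_ext (fun j => u ^ S j * _)
    (fun j => u * (u ^ j * binom (INR (j + S k)) (S k))
    + u ^ S j * binom (INR (S j + k)) k)) in H.
  2:{ intros j; rewrite Nat.add_succ_l, binom_INR_S, <- Nat.add_succ_comm.
      simpl pow; ring. }
  rewrite Series_plus, Series_scal_l in H;
    [|now apply (ex_series_scal_l (V := R_NormedModule) u)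
     |now apply (ex_series_incr_1 (fun j => u ^ j * binom (INR (j + k)) k))].
  rewrite !Nat.add_0_l, !binom_diag in *.
  set (X := Series _) in *; set (Y := Series _) in *.
  assert (HX : (1 - u) * X = / (1 - u) ^ S k) by lra.
  apply (Rmult_eq_reg_l (1 - u)); [|lra]; rewrite HX; simpl; field.
  split; [apply pow_nonzero|]; lra.
Qed.

(* For [P] the Legendre polynomials,
   [legendre_sum k t = (1 - t) ^ k * P k ((1 + t) / (1 - t))]. *)
Definition legendre_sum (k : nat) (t : R) : R :=
  sum_f_R0 (fun i => binom (INR k) i ^ 2 * t ^ i) k.

Lemma legendre_sum_extend (k N : nat) (t : R) : (k <= N)%nat ->
  sum_f_R0 (fun i => binom (INR k) i ^ 2 * t ^ i) N = legendre_sum k t.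
Proof.
intros HN; apply sum_f_R0_extend; [|easy].
intros i Hi; rewrite binom_gt by easy; simpl; ring.
Qed.

Lemma is_series_legendre (k : nat) (t : R) :
  is_series (fun i => binom (INR k) i ^ 2 * t ^ i) (legendre_sum k t).
Proof.
apply (is_series_finite (fun i => binom (INR k) i ^ 2 * t ^ i)).
intros i Hi; rewrite binom_gt by easy; simpl; ring.
Qed.

(** On the diagonal the signs of [shifted_coef_add] are squared away, and [q ^ n] absorbs all but
    $q^{-(n-j)}$. The result is shaped as the coefficient of a Cauchy product. *)
Lemma pairing_meixner_diag (q : R) (k n : nat) : 0 < q < 1 ->
  (1 - q) * q ^ n * pairing q k (meixner_sum q n) (meixner_sum q n)
  = (q / (1 - q)) ^ k * sum_f_R0 (fun j => binom (INR (j + k)) k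
      * (binom (INR k) (n - j) ^ 2 * (/ q) ^ (n - j))) n.
Proof.
intros Hq; rewrite (pairing_meixner q k n n n) by (easy || lia).
assert (Hpow : (1 - q) ^ k <> 0) by (apply pow_nonzero; lra).
transitivity ((q / (1 - q)) ^ k * (q ^ n * sum_f_R0 (fun j =>
  shifted_coef q k j n * shifted_coef q k j n * negbin_coef q k j) n)).
- unfold Rdiv; rewrite Rpow_mult_distr, pow_inv; simpl pow; field; lra.
- f_equal; rewrite scal_sum; apply sum_eq; intros j Hj.
  assert (En : n = (j + (n - j))%nat) by lia; set (i := (n - j)%nat) in *.
  rewrite En, shifted_coef_add, pow_add; unfold negbin_coef.
  assert (Hq' : forall e, q ^ e * (/ q) ^ e = 1).
  { intros e; rewrite <- Rpow_mult_distr, Rinv_r by lra; apply pow1. }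
  assert (Hs : (- / q) ^ i * (- / q) ^ i = (/ q) ^ i * (/ q) ^ i).
  { rewrite <- !Rpow_mult_distr; f_equal; ring. }
  transitivity (binom (INR k) i ^ 2 * ((- / q) ^ i * (- / q) ^ i) * q ^ i
    * binom (INR (j + k)) k * (q ^ j * (/ q) ^ j)); [ring|].
  rewrite Hs, Hq'.
  transitivity (binom (INR k) i ^ 2 * (/ q) ^ i * (q ^ i * (/ q) ^ i)
    * binom (INR (j + k)) k); [ring|].
  rewrite Hq'; ring.
Qed.

Lemma is_series_sum (f : nat -> nat -> R) (l : nat -> R) (N : nat) :
  (forall i, is_series (f i) (l i)) ->
  is_series (fun x => sum_f_R0 (fun i => f i x) N) (sum_f_R0 l N).
Proof.
intros H; induction N as [|N IH]; simpl; [apply H|].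
now apply is_series_plus_R.
Qed.

Lemma is_series_moment_term (q : R) (k m : nat) : 0 < q < 1 ->
  is_series (moment_term (m + 1) q k)
    (INR (Factorial.fact k) / INR (m + 1) * sum_f_R0 (fun n => (1 - q) * q ^ n
      * pairing q k (meixner_sum q n) (meixner_sum q n)) m).
Proof.
intros Hq.
eapply is_series_ext_R; [|apply is_series_scal_R,
  (is_series_sum (fun n x => (1 - q) * q ^ n * (q ^ x * (binom (INR x) k
     * meixner_sum q n x * meixner_sum q n x))))].
- intros x; unfold moment_term, one_point.
  replace (m + 1 - 1)%nat with m by lia.
  unfold Rdiv; rewrite (Rmult_comm (INR _) (/ _)), (Rmult_comm (falling _ _)).
  rewrite !Rmult_assoc; f_equal; rewrite !scal_sum, (Rmult_comm _ (falling _ _)).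
  rewrite scal_sum.
  apply sum_eq; intros n _; unfold geom_weight.
  replace (meixner q n x * (meixner q n x * 1))
    with (meixner q n x ^ 2) by ring.
  rewrite meixner_sqr by lra; unfold binom; field; apply INR_fact_neq_0.
- intros n; apply is_series_scal_R, Series_correct.
  apply ex_series_subexp; [|easy].
  repeat apply subexp_mult; try apply subexp_meixner_sum.
  + apply subexp_falling, subexp_INR.
  + apply subexp_const.
Qed.

(** Two Cauchy products of nonnegative series: the negative binomial series times the Legendre sum
    yields the sum over [n] of the pairings, and a geometric series then produces the partial sums
    over [n <= m] of the one-point function. The weight [m + 1] cancels the normalisation of that
    function. *)
Lemma is_series_negbin_term (q t : R) (k : nat) :
  0 < q < 1 -> 0 < t -> t * q < 1 ->
  is_series (negbin_term q k t)
    (INR (Factorial.fact k) * (q / ((1 - q) * (1 - t * q))) ^ k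
     * legendre_sum k t).
Proof.
intros Hq Ht Htq; assert (Hu : 0 < t * q < 1) by (split; [nra|lra]).
assert (H1 : is_series (fun n => (t * q) ^ n * ((1 - q) * q ^ n
    * pairing q k (meixner_sum q n) (meixner_sum q n)))
  ((q / (1 - q)) ^ k * (/ (1 - t * q) ^ S k * legendre_sum k t))).
{ eapply is_series_ext_R; [|apply is_series_scal_R,
    is_series_mult_pos; [apply (is_series_negbin k _ Hu)|
      apply (is_series_legendre k t)|..]].
  - intros n; cbv beta.
    rewrite (pairing_meixner_diag q k n Hq), (Rmult_comm ((t * q) ^ n)).
    rewrite Rmult_assoc; f_equal; rewrite (Rmult_comm _ ((t * q) ^ n)), scal_sum.
    apply sum_eq; intros j Hj.
    assert (En : n = (j + (n - j))%nat) by lia; set (i := (n - j)%nat) in *.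
    rewrite En, pow_add, (Rpow_mult_distr t q i), pow_inv.
    field; apply pow_nonzero; lra.
  - intros j; apply Rmult_le_pos; [apply pow_le; lra|apply binom_ge_0].
  - intros j; apply Rmult_le_pos; [apply pow2_ge_0|apply pow_le; lra]. }
assert (Hnn : forall n, 0 <= (t * q) ^ n * ((1 - q) * q ^ n
    * pairing q k (meixner_sum q n) (meixner_sum q n))).
{ intros n; rewrite pairing_meixner_diag by easy.
  apply Rmult_le_pos; [apply pow_le; lra|].
  apply Rmult_le_pos; [apply pow_le, Rlt_le, Rdiv_lt_0_compat; lra|].
  apply cond_pos_sum; intros j; apply Rmult_le_pos; [apply binom_ge_0|].
  apply Rmult_le_pos; [apply pow2_ge_0|apply pow_le].
  apply Rlt_le, Rinv_0_lt_compat; lra. }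
(* The ratio [t * q] agrees with the power already in [H1], so the [m]-th product coefficient is
   [(t * q) ^ m] times a plain partial sum. *)
assert (H2 : is_series (fun n => (t * q) ^ n) (/ (1 - t * q))).
{ apply is_series_geom; rewrite Rabs_pos_eq; lra. }
assert (H3 := is_series_mult_pos _ _ _ _ H1 H2 Hnn
  (fun n => pow_le (t * q) n (Rlt_le _ _ (proj1 Hu)))).
apply (is_series_scal_R
  (INR (Factorial.fact k) * (1 - t * q) ^ 2)) in H3.
replace (INR (Factorial.fact k) * (q / ((1 - q) * (1 - t * q))) ^ k
     * legendre_sum k t) with
  (INR (Factorial.fact k) * (1 - t * q) ^ 2
    * ((q / (1 - q)) ^ k * (/ (1 - t * q) ^ S k * legendre_sum k t)
     * / (1 - t * q))).
- eapply is_series_ext_R; [|exact H3].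
  intros m; cbv beta; unfold negbin_term.
  rewrite (is_series_unique _ _ (is_series_moment_term q k m Hq)).
  rewrite (sum_eq _ (fun n => (1 - q) * q ^ n
    * pairing q k (meixner_sum q n) (meixner_sum q n) * (t * q) ^ m)).
  + rewrite <- scal_sum; set (s := sum_f_R0 _ m).
    field; apply not_0_INR; lia.
  + intros n Hn; assert (Em : m = (n + (m - n))%nat) by lia; set (i := (m - n)%nat) in *.
    rewrite Em, pow_add; ring.
- replace (q / ((1 - q) * (1 - t * q))) with (q / (1 - q) * / (1 - t * q))
    by (field; lra).
  rewrite Rpow_mult_distr, pow_inv; set (a := (q / (1 - q)) ^ k).
  simpl pow; field; split; [apply pow_nonzero|]; lra.
Qed.

Lemma negbin_moment_closed_form (q t : R) (k : nat) :
  0 < q < 1 -> 0 < t -> t * q < 1 ->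
  negbin_moment q k t = INR (Factorial.fact k)
    * (q / ((1 - q) * (1 - t * q))) ^ k * legendre_sum k t.
Proof. intros; now apply is_series_unique, is_series_negbin_term. Qed.

(** * Three-term recurrence of the Legendre sums *)

(** The coefficient of $t^{i+2}$ in [legendre_sum_recurrence]. *)
Lemma binom_sqr_recurrence (k i : nat) :
  (INR k + 2) * binom (INR (S (S k))) (S (S i)) ^ 2
  = (2 * INR k + 3) * (binom (INR (S k)) (S (S i)) ^ 2
                       + binom (INR (S k)) (S i) ^ 2)
    - (INR k + 1) * (binom (INR k) (S (S i)) ^ 2 - 2 * binom (INR k) (S i) ^ 2
                     + binom (INR k) i ^ 2).
Proof.
assert (H1 := binom_S (INR k) (S i)); assert (H2 := binom_S (INR k) i).
rewrite !binom_INR_S; rewrite !S_INR in *.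
set (a := binom _ i) in *; set (b := binom _ (S i)) in *;
  set (c := binom _ (S (S i))) in *.
apply Rminus_diag_uniq.
(* The difference of the two sides is a combination of the relations [H1] and [H2] between
   neighbouring binomials, with multipliers [a + b] and [b + c]. *)
transitivity (2 * (((INR i + 1 + 1) * c - (INR k - (INR i + 1)) * b) * (a + b)
  - ((INR i + 1) * b - (INR k - INR i) * a) * (b + c))); [ring|].
rewrite H1, H2; ring.
Qed.

(** Bonnet's recurrence for Legendre polynomials at $(1+t)/(1-t)$, multiplied by $(1-t)^{k+2}$. *)
Lemma legendre_sum_recurrence (k : nat) (t : R) :
  (INR k + 2) * legendre_sum (S (S k)) t
  = (2 * INR k + 3) * (1 + t) * legendre_sum (S k) t
    - (INR k + 1) * (1 - t) ^ 2 * legendre_sum k t.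
Proof.
pose (L := fun k N => sum_f_R0 (fun i => binom (INR k) i ^ 2 * t ^ i) N).
(* The last two summands remove what the factors [1 + t] and [(1 - t) ^ 2] push beyond $t^{N+1}$;
   they vanish at [N = k + 2]. *)
assert (H : forall N, (INR k + 2) * L (S (S k)) (S N)
  = (2 * INR k + 3) * (1 + t) * L (S k) (S N)
    - (INR k + 1) * (1 - t) ^ 2 * L k (S N)
    - (2 * INR k + 3) * binom (INR (S k)) (S N) ^ 2 * t ^ S (S N)
    + (INR k + 1) * ((binom (INR k) N ^ 2 - 2 * binom (INR k) (S N) ^ 2)
                       * t ^ S (S N) + binom (INR k) (S N) ^ 2 * t ^ S (S (S N)))).
{ induction N as [|N IH].
  - assert (H1 := binom_S (INR k) 0); rewrite binom_0_r in H1.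
    unfold L; cbn [sum_f_R0]; rewrite !binom_INR_S, !binom_0_r.
    replace (binom (INR k) 1) with (INR k) by (simpl in H1; lra).
    simpl; ring.
  - unfold L in *; rewrite (tech5 _ (S N)), Rmult_plus_distr_l, IH.
    rewrite <- Rmult_assoc, binom_sqr_recurrence, !(tech5 _ (S N)).
    simpl pow; ring. }
specialize (H (S (S k))); unfold L in H.
rewrite !legendre_sum_extend, !binom_gt in H by lia.
rewrite H; ring.
Qed.

Lemma legendre_sum_1 (t : R) : legendre_sum 1 t = (1 + t) * legendre_sum 0 t.
Proof.
unfold legendre_sum; cbn [sum_f_R0]; rewrite !binom_0_r, binom_diag; simpl; ring.
Qed.

(** * Differential equation of the Legendre sums *)

Definition legendre_sum_d1 (k : nat) (t : R) : R :=
  sum_f_R0 (fun i => binom (INR k) i ^ 2 * (INR i * t ^ pred i)) k.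

(** Truncation by [pred] is harmless: a factor [INR i] or [INR (pred i)] is 0 whenever it occurs. *)
Definition legendre_sum_d2 (k : nat) (t : R) : R :=
  sum_f_R0 (fun i => binom (INR k) i ^ 2
    * (INR i * (INR (pred i) * t ^ pred (pred i)))) k.

Lemma is_derive_sum_f_R0 (f : nat -> R -> R) (d : nat -> R) (N : nat) (x : R) :
  (forall i, is_derive (f i) x (d i)) ->
  is_derive (fun y => sum_f_R0 (fun i => f i y) N) x (sum_f_R0 d N).
Proof.
intros H; induction N as [|N IH]; simpl; [apply H|].
now apply (is_derive_plus (V := R_NormedModule)).
Qed.

Lemma is_derive_legendre_sum (k : nat) (t : R) :
  is_derive (legendre_sum k) t (legendre_sum_d1 k t).
Proof.
apply (is_derive_sum_f_R0 (fun i y => binom (INR k) i ^ 2 * y ^ i)); intros i.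
auto_derive; [easy|ring].
Qed.

Lemma is_derive_legendre_sum_d1 (k : nat) (t : R) :
  is_derive (legendre_sum_d1 k) t (legendre_sum_d2 k t).
Proof.
apply (is_derive_sum_f_R0
  (fun i y => binom (INR k) i ^ 2 * (INR i * y ^ pred i))); intros i.
auto_derive; [easy|ring].
Qed.

(** The hypergeometric equation of ${}_2F_1(-k,-k;1;t)$. Truncating at [N] leaves a single remainder
    with factor $k - N$, which vanishes at [N = k]. *)
Lemma legendre_sum_ode (k : nat) (t : R) :
  t * (1 - t) * legendre_sum_d2 k t
  + (1 + (2 * INR k - 1) * t) * legendre_sum_d1 k t
  - INR k ^ 2 * legendre_sum k t = 0.
Proof.
assert (H : forall N,
  t * (1 - t) * sum_f_R0 (fun i => binom (INR k) i ^ 2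
    * (INR i * (INR (pred i) * t ^ pred (pred i)))) N
  + (1 + (2 * INR k - 1) * t)
    * sum_f_R0 (fun i => binom (INR k) i ^ 2 * (INR i * t ^ pred i)) N
  - INR k ^ 2 * sum_f_R0 (fun i => binom (INR k) i ^ 2 * t ^ i) N
  = - ((INR k - INR N) * binom (INR k) N) ^ 2 * t ^ N).
{ (* Telescoping, by [(i + 1)^2 binom k (i + 1) ^ 2 = (k - i)^2 binom k i ^ 2]. *)
  induction N as [|N IH].
  - simpl; rewrite binom_0_r; ring.
  - rewrite !tech5.
    match type of IH with ?a * ?x + ?b * ?y - ?c * ?z = _ =>
      match goal with |- _ * (_ + ?u) + _ * (_ + ?v) - _ * (_ + ?w) = _ =>
        transitivity ((a * x + b * y - c * z) + (a * u + b * v - c * w));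
        [ring|rewrite IH] end end.
    rewrite <- binom_S; destruct N as [|N]; cbn [pred]; rewrite !S_INR;
      simpl; ring. }
unfold legendre_sum, legendre_sum_d1, legendre_sum_d2; rewrite H; ring.
Qed.

(** * Derivatives of the closed form *)

(** The closed form is available only for $0 < y < 1/q$; differentiating it at [t] requires it on a
    neighbourhood. *)
Lemma locally_open_interval (q t : R) : 0 < q -> 0 < t -> t * q < 1 ->
  locally t (fun y => 0 < y /\ y * q < 1).
Proof.
intros Hq Ht Htq; apply filter_and; [now apply open_gt|].
apply (filter_imp (fun y => y < / q)).
- intros y Hy; apply (Rmult_lt_compat_r q) in Hy; [|easy].
  rewrite Rinv_l in Hy; lra.
- apply open_lt; apply (Rmult_lt_reg_r q); [easy|rewrite Rinv_l; lra].
Qed.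

Lemma is_derive_mult_R (f g : R -> R) (x df dg : R) :
  is_derive f x df -> is_derive g x dg ->
  is_derive (fun y => f y * g y) x (df * g x + f x * dg).
Proof. intros Hf Hg; exact (is_derive_mult f g x df dg Hf Hg Rmult_comm). Qed.

(** The derivative is kept as a multiple of the same power, so that this power factors out of the
    differential equation. *)
Lemma is_derive_inv_pow (q y : R) (k : nat) : y * q < 1 ->
  is_derive (fun y => (/ (1 - y * q)) ^ k) y
    (INR k * q / (1 - y * q) * (/ (1 - y * q)) ^ k).
Proof.
intros Hy; auto_derive; [lra|].
destruct k as [|k]; cbn [pred]; [simpl; field; lra|].
rewrite <- tech_pow_Rmult; change (1 + - (y * q)) with (1 - y * q).
set (w := (/ (1 - y * q)) ^ k); field; lra.
Qed.

Definition moment_form (q : R) (k : nat) (t : R) : R :=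
  (/ (1 - t * q)) ^ k * legendre_sum k t.

Definition moment_form_d1 (q : R) (k : nat) (t : R) : R :=
  (/ (1 - t * q)) ^ k
  * (legendre_sum_d1 k t + INR k * q / (1 - t * q) * legendre_sum k t).

Definition moment_form_d2 (q : R) (k : nat) (t : R) : R :=
  (/ (1 - t * q)) ^ k
  * (legendre_sum_d2 k t + 2 * INR k * q / (1 - t * q) * legendre_sum_d1 k t
     + INR k * (INR k + 1) * q ^ 2 / (1 - t * q) ^ 2 * legendre_sum k t).

Lemma is_derive_moment_form (q t : R) (k : nat) : t * q < 1 ->
  is_derive (moment_form q k) t (moment_form_d1 q k t).
Proof.
intros Ht; evar_last; [apply is_derive_mult_R;
  [now apply is_derive_inv_pow|apply is_derive_legendre_sum]|].
unfold moment_form_d1; ring.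
Qed.

Lemma is_derive_moment_form_d1 (q t : R) (k : nat) : t * q < 1 ->
  is_derive (moment_form_d1 q k) t (moment_form_d2 q k t).
Proof.
intros Ht; unfold moment_form_d1.
assert (H : is_derive (fun y => INR k * q / (1 - y * q)) t
  (INR k * q ^ 2 / (1 - t * q) ^ 2)).
{ auto_derive; [lra|field; lra]. }
assert (H' : is_derive (fun y => legendre_sum_d1 k y
    + INR k * q / (1 - y * q) * legendre_sum k y) t
  (legendre_sum_d2 k t + (INR k * q ^ 2 / (1 - t * q) ^ 2 * legendre_sum k t
    + INR k * q / (1 - t * q) * legendre_sum_d1 k t))).
{ apply (is_derive_plus (V := R_NormedModule));
    [apply is_derive_legendre_sum_d1|].
  apply (is_derive_mult_R (fun y => INR k * q / (1 - y * q)));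
    [exact H|apply is_derive_legendre_sum]. }
evar_last; [apply is_derive_mult_R;
  [now apply is_derive_inv_pow|exact H']|].
unfold moment_form_d2; cbv beta; set (w := (/ (1 - t * q)) ^ k); field; lra.
Qed.

(** * Recurrence and differential equation of the moments *)

(* The first four conjuncts say that the moments and their first two
   derivatives exist, so that the totalised [Series] and [Derive] denote the
   actual sums and derivatives. For [k = 0], [(k - 1)%nat] is [0], but the
   coefficient of that term vanishes. *)
Theorem corollary6 :
  forall (q t : R) (k : nat),
    0 < q < 1 -> 0 < t -> t * q < 1 ->
    (forall m : nat, ex_series (moment_term (m + 1) q k))
    /\ ex_series (negbin_term q k t)
    /\ ex_derive (negbin_moment q k) t
    /\ ex_derive_n (negbin_moment q k) 2 t
    /\ negbin_moment q (k + 1) t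
       = (2 * INR k + 1) * q * (1 + t) / ((1 - q) * (1 - t * q))
           * negbin_moment q k t
         - (INR k * q * (1 - t) / ((1 - q) * (1 - t * q))) ^ 2
           * negbin_moment q (k - 1) t
    /\ t * (1 - t) * Derive_n (negbin_moment q k) 2 t
       + (q * t ^ 2 - (1 - 2 * INR k * (1 - q) + q) * t + 1) / (1 - q * t)
         * Derive (negbin_moment q k) t
       - (INR k * q * (1 - t) + (INR k) ^ 2 * (1 - q ^ 2 * t)) / (1 - q * t) ^ 2
         * negbin_moment q k t
       = 0.
Proof.
intros q t k Hq Ht Htq.
split; [intros m; eexists; now apply is_series_moment_term|].
split; [eexists; now apply is_series_negbin_term|].
set (c := INR (Factorial.fact k) * (q / (1 - q)) ^ k).
assert (HM : forall y, 0 < y -> y * q < 1 ->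
  negbin_moment q k y = c * moment_form q k y).
{ intros y Hy Hyq; rewrite negbin_moment_closed_form by easy.
  replace (q / ((1 - q) * (1 - y * q))) with (q / (1 - q) * / (1 - y * q))
    by (field; lra).
  unfold c, moment_form; rewrite Rpow_mult_distr; ring. }
assert (HD : forall y, 0 < y -> y * q < 1 ->
  is_derive (negbin_moment q k) y (c * moment_form_d1 q k y)).
{ intros y Hy Hyq; apply (is_derive_ext_loc (fun y => c * moment_form q k y)).
  - apply (filter_imp (fun y => 0 < y /\ y * q < 1)).
    + intros z [Hz Hzq]; now rewrite HM.
    + now apply locally_open_interval.
  - apply (is_derive_scal (moment_form q k)), is_derive_moment_form; easy. }
assert (HD2 : is_derive (Derive (negbin_moment q k)) t (c * moment_form_d2 q k t)).
{ apply (is_derive_ext_loc (fun y => c * moment_form_d1 q k y)).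
  - apply (filter_imp (fun y => 0 < y /\ y * q < 1)).
    + intros z [Hz Hzq]; symmetry; now apply is_derive_unique, HD.
    + now apply locally_open_interval.
  - apply (is_derive_scal (moment_form_d1 q k)), is_derive_moment_form_d1; easy. }
split; [eexists; now apply HD|].
split; [eexists; exact HD2|].
split.
- rewrite !negbin_moment_closed_form by easy.
  destruct k as [|k].
  (* [legendre_sum_recurrence] starts at index 2, so [k = 0] rests on [legendre_sum_1]. *)
  + simpl Nat.add; rewrite legendre_sum_1; simpl; field; lra.
  + replace (S k + 1)%nat with (S (S k)) by lia.
    replace (S k - 1)%nat with k by lia.
    rewrite !fact_simpl, !mult_INR, !S_INR; simpl pow.
    set (r := q / ((1 - q) * (1 - t * q))); set (p := r ^ k).
    set (f := INR (Factorial.fact k)).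
    (* The factor [INR k + 2] split off from $(k+2)!$ is the one on the left of
       [legendre_sum_recurrence]. *)
    transitivity ((INR k + 1) * f * (r * r * p)
      * ((INR k + 2) * legendre_sum (S (S k)) t)); [ring|].
    rewrite legendre_sum_recurrence; clearbody p; unfold r; field; lra.
- change (Derive_n (negbin_moment q k) 2 t)
    with (Derive (Derive (negbin_moment q k)) t).
  rewrite (is_derive_unique _ _ _ HD2), (is_derive_unique _ _ _ (HD t Ht Htq)).
  rewrite (HM t Ht Htq).
  unfold moment_form, moment_form_d1, moment_form_d2.
  set (w := (/ (1 - t * q)) ^ k).
  (* The terms from differentiating $(1-tq)^{-k}$ combine with the given coefficients so that
     exactly [c * w] times the Legendre-sum equation remains. *)
  transitivity (c * w * (t * (1 - t) * legendre_sum_d2 k t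
    + (1 + (2 * INR k - 1) * t) * legendre_sum_d1 k t
    - INR k ^ 2 * legendre_sum k t)).
  + field; lra.
  + rewrite legendre_sum_ode; ring.
Qed.
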